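(* Let $k \ge r \ge 3$ be integers such that $k = 2r-3$, or $k \ge 2r-2$ and $r \equiv 0 \pmod 2$, or $k \ge 2r-1$ and $r \equiv 2 \pmod 3$. Then \[ sat(n,k,r) = k(2r-4)\,n + O(1) \quad\text{as } n \to \infty. \]
   Context: All graphs are finite and simple. A $k$-partite graph comes with a fixed partition of its vertex set into $k$ parts. An admissible non-edge is a non-adjacent pair of vertices in different parts. A $k$-partite graph is $K_r$-partite-saturated if it contains no $K_r$ but adding any admissible non-edge creates a copy of $K_r$. $sat(n,k,r)$ is the minimum number of edges of a $K_r$-partite-saturated $k$-partite graph with exactly $n$ vertices in each of its $k$ parts. *)

(* Defs.v *)
From mathcomp Require Export all_boot all_order all_algebra.

Set Implicit Arguments.
Unset Strict Implicit.
Unset Printing Implicit Defensive.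

(* A simple graph on the finite vertex type V is given by its edge set
   E : {set {set V}}, so that #|E| is its number of edges.  The fixed partition
   into k parts is the map part : V -> 'I_k, and [partite] says that every edge
   is a pair {u, v} with u and v in different parts (in particular u != v). *)

Section PartiteGraphs.
Variables (V : finType) (k : nat) (part : V -> 'I_k).
Implicit Types (E : {set {set V}}) (Q : {set V}).

Definition partite E : bool :=
  [forall e in E, [exists u, exists v,
     (part u != part v) && (e == [set u; v])]].

Definition clique E Q : bool :=
  [forall u in Q, forall v in Q, (u != v) ==> ([set u; v] \in E)].

Definition has_clique (r : nat) E : bool :=
  [exists Q : {set V}, (#|Q| == r) && clique E Q].

Definition admissible_nonedge E (u v : V) : bool :=
  (part u != part v) && ([set u; v] \notin E).

Definition partite_saturated (r : nat) E : bool :=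
  ~~ has_clique r E &&
  [forall u, forall v,
     admissible_nonedge E u v ==> has_clique r ([set u; v] |: E)].

Lemma partite_saturated_exists r :
  1 < r -> exists E, partite E && partite_saturated r E.
Proof.
move=> r1; pose P E := partite E && ~~ has_clique r E.
have P0 : P set0.
  apply/andP; split; first by apply/forall_inP => e; rewrite inE.
  apply/negP => /existsP[Q /andP[/eqP cQ /forall_inP QE]].
  have /card_gt1P[u [v [uQ vQ uv]]] : 1 < #|Q| by rewrite cQ.
  by have /forall_inP/(_ v vQ) := QE u uQ; rewrite uv inE.
have [E /maxsetP[/andP[pE nE] maxE] _] := @maxset_exists _ P _ P0.
exists E; rewrite pE /partite_saturated nE /=.
apply/forallP => u; apply/forallP => v; apply/implyP => /andP[puv uvE].
have [//|nc] := boolP (has_clique r ([set u; v] |: E)); move: uvE.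
rewrite -(maxE ([set u; v] |: E)) ?setU11 ?subsetUr //.
rewrite /P nc andbT; apply/forall_inP => e /setU1P[->|eE]; last first.
  by move/forall_inP: pE => /(_ e eE).
by apply/existsP; exists u; apply/existsP; exists v; rewrite puv eqxx.
Qed.

End PartiteGraphs.

(* Up to isomorphism, a vertex set split into k parts of exactly n vertices is
   'I_k * 'I_n with the first projection as the part map. *)
Definition blowup_part (k n : nat) (x : 'I_k * 'I_n) : 'I_k := x.1.
Arguments blowup_part : clear implicits.

Definition saturated_graph (n k r : nat) : pred {set {set 'I_k * 'I_n}} :=
  fun E => partite (blowup_part k n) E
           && partite_saturated (blowup_part k n) r E.
Arguments saturated_graph : clear implicits.

(* The default set0 of the arg min is irrelevant for 1 < r, see satP. *)
Definition sat (n k r : nat) : nat :=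
  #|[arg min_(E < set0 | saturated_graph n k r E) #|E|]|.

Lemma satP (n k r : nat) : 1 < r ->
  (exists2 E, saturated_graph n k r E & #|E| = sat n k r) /\
  (forall E, saturated_graph n k r E -> sat n k r <= #|E|).
Proof.
move=> r1; have [E0 sE0] : exists E, saturated_graph n k r E.
  exact: partite_saturated_exists.
rewrite /sat /arg_min /extremum; case: pickP => [E /andP[sE /forall_inP mE] | no] /=.
  by split; [exists E | exact: mE].
have [E sE mE] := arg_minnP (fun E : {set _} => #|E|) sE0.
by have /negP[] := negbT (no E); apply/andP; split=> //; apply/forall_inP.
Qed.

(* Main.v *)
(* Lower bound.  Put m = 2r-4 and let x be a vertex outside a set S with
   deg x + deg_S x < 2m, so that deg_S x < m.  If every part j other than that
   of x had a vertex y outside N(x) all of whose common neighbours with x lie in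
   S, then N(x) :&: S would contain, for each such j, a K_(r-2) avoiding part j;
   as N(x) contains no K_(r-1), Hajnal's inequality
   |union| + |intersection| >= 2(r-2) for maximum cliques would give deg_S x >= m.
   So replacing S by S :|: N(x) increases, for some j, the least number of
   neighbours in S of the vertices of part j outside S.  After boundedly many
   steps either one part alone sends k * m * n - O(1) edges to S, or every v
   outside S has deg v + deg_S v >= 2m; summing over v bounds 2|E|.

   Upper bound.  Write r = d * h + 2, g = 2h+1 and N = d * g with d = 1, 2, 3 in
   the three cases.  Put one core vertex in each of the first N parts, carrying
   the complement of the cycle of length N, and join every other vertex to the
   N - d = m core vertices outside one residue class mod g, that of its own part.
   This graph is K_r-free, and every admissible non-edge not inside the core
   would complete a K_r, so a maximal K_r-free extension has only O(1) more
   edges. *)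
Require Import Defs.
From mathcomp Require Import zify.
Import Order.TTheory GRing.Theory Num.Theory.

(** * Cliques and neighbourhoods in partite graphs *)

Section Partite.
Set Implicit Arguments.
Unset Strict Implicit.
Variables (V : finType) (k : nat) (part : V -> 'I_k).
Implicit Types (E : {set {set V}}) (S T Q K U I A : {set V}) (u v w x y z : V).

Lemma partite_edge E u v :
  partite part E -> [set u; v] \in E -> part u != part v.
Proof.
move=> /forall_inP pE /pE/existsP[a /existsP[b /andP[ab /eqP uvab]]].
have : a \in [set u; v] by rewrite uvab set21.
have : b \in [set u; v] by rewrite uvab set22.
rewrite !inE => /orP[]/eqP eb /orP[]/eqP ea; move: ab; rewrite ea eb ?eqxx //.
by rewrite eq_sym.
Qed.

Lemma partite_edge_neq E u v : partite part E -> [set u; v] \in E -> u != v.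
Proof. by move=> pE /(partite_edge pE); apply: contraNneq => ->. Qed.

Lemma partite_card_edge E e : partite part E -> e \in E -> #|e| = 2.
Proof.
move=> /forall_inP pE /pE/existsP[a /existsP[b /andP[ab /eqP->]]].
by rewrite cards2; have -> : a != b by apply: contraNneq ab => ->.
Qed.

Lemma cliqueP E Q :
  reflect {in Q &, forall u v, u != v -> [set u; v] \in E} (clique E Q).
Proof.
apply: (iffP forall_inP) => [c u v uQ vQ uv | c u uQ].
  by have /forall_inP/(_ v vQ)/implyP := c u uQ; apply.
by apply/forall_inP => v vQ; apply/implyP; exact: c.
Qed.

Lemma has_cliqueP r E :
  reflect (exists2 Q : {set V}, #|Q| = r & clique E Q) (has_clique r E).
Proof.
by apply: (iffP existsP) => [[Q /andP[/eqP]]|[Q cQ QE]]; exists Q => //; rewrite cQ eqxx.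
Qed.

Lemma clique_subset E A Q : A \subset Q -> clique E Q -> clique E A.
Proof.
by move=> /subsetP AB /cliqueP cB; apply/cliqueP => u v /AB uB /AB vB; exact: cB.
Qed.

Lemma has_clique_geq E Q r : clique E Q -> r <= #|Q| -> has_clique r E.
Proof.
move=> cQ /card_geqP[s [us sr sQ]]; apply/has_cliqueP; exists [set x in s].
  by rewrite cardsE (card_uniqP us).
by apply: clique_subset cQ; apply/subsetP => x; rewrite inE => /sQ.
Qed.

Definition nbr E v := [set u | [set u; v] \in E].

Lemma mem_nbr E u v : (u \in nbr E v) = ([set u; v] \in E).
Proof. by rewrite inE. Qed.

Lemma nbr_sym E u v : (u \in nbr E v) = (v \in nbr E u).
Proof. by rewrite !inE setUC. Qed.

Lemma clique_setU1 E v Q : clique E Q -> Q \subset nbr E v -> clique E (v |: Q).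
Proof.
move=> /cliqueP cQ /subsetP Qv; apply/cliqueP => a b.
move=> /setU1P[->|aQ] /setU1P[->|bQ]; rewrite ?eqxx //; last exact: cQ.
- by move=> _; rewrite setUC -mem_nbr Qv.
- by move=> _; rewrite -mem_nbr Qv.
Qed.

(** The new [r]-clique contains both [u] and [v], since otherwise all its pairs are old edges;
    removing them leaves [K]. *)
Lemma new_clique E u v r : ~~ has_clique r E -> u != v ->
  has_clique r ([set u; v] |: E) ->
  exists2 K : {set V}, #|K| = r - 2 & clique E K /\ K \subset nbr E u :&: nbr E v.
Proof.
move=> nE uv /has_cliqueP[Q Qr /cliqueP cQ].
have uvQ : [set u; v] \subset Q.
  apply: contraNT nE => uvQ; apply/has_cliqueP; exists Q => //.
  apply/cliqueP => a b aQ bQ ab; have := cQ a b aQ bQ ab.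
  case/setU1P => // abE; case/negP: uvQ; rewrite -abE.
  by apply/subsetP => c; rewrite !inE => /orP[]/eqP->.
have [uQ vQ] : u \in Q /\ v \in Q.
  by split; apply: (subsetP uvQ); rewrite !inE eqxx ?orbT.
have old a b : a \in Q -> b \in Q -> a != b -> a \notin [set u; v] ->
    [set a; b] \in E.
  move=> aQ bQ ab auv; have := cQ a b aQ bQ ab; case/setU1P => // abE.
  by move: auv; rewrite -abE set21.
exists (Q :\: [set u; v]).
  by rewrite cardsD (setIidPr uvQ) cards2 uv Qr.
split.
  apply/cliqueP => a b /setDP[aQ auv] /setDP[bQ _] ab; exact: old.
apply/subsetP => a /setDP[aQ auv]; rewrite !inE !old //.
- by apply: contraNneq auv => ->; rewrite set22.
- by apply: contraNneq auv => ->; rewrite set21.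
Qed.

(* Hajnal: if [U] and [I] are the union and the intersection of the cliques
   treated so far and [A] is the next one, then [(A :&: U) :|: I] is a clique,
   so it has at most [w] vertices, i.e. [#|I :\: A| <= #|A :\: U|]. *)
Lemma max_cliques_bound E T (w : nat) (J : eqType) (j0 : J) (s : seq J) (K : J -> {set V}) :
  (forall Q : {set V}, Q \subset T -> clique E Q -> #|Q| <= w) ->
  (forall j, j \in j0 :: s -> [/\ K j \subset T, clique E (K j) & #|K j| = w]) ->
  exists U I : {set V}, [/\ U \subset T, 2 * w <= #|U| + #|I| &
    [/\ I \subset U, forall u z, u \in U -> z \in I -> u != z -> [set u; z] \in E &
      forall j, j \in j0 :: s -> I \subset K j]].
Proof.
move=> maxT; elim: s => [|a s IHs] Ks.
  have [KT /cliqueP cK Kw] := Ks j0 (mem_head _ _).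
  exists (K j0), (K j0); split=> //; first by rewrite Kw; lia.
  split; first exact: subxx.
    by move=> u z uK zK; exact: cK.
  by move=> j; rewrite inE => /eqP->.
have [] := IHs.
  by move=> j js; apply: Ks; move: js; rewrite !inE => /orP[]->; rewrite ?orbT.
move=> U [I [UT UI [IU UIE IK]]].
have [AT /cliqueP cA Aw] : [/\ K a \subset T, clique E (K a) & #|K a| = w].
  by apply: Ks; rewrite !inE eqxx orbT.
set A := K a in AT cA Aw.
have cAUI : clique E ((A :&: U) :|: I).
  apply/cliqueP => u v /setUP[/setIP[uA uU]|uI] /setUP[/setIP[vA vU]|vI] uv.
  - exact: cA.
  - exact: UIE.
  - by rewrite setUC; apply: UIE => //; rewrite eq_sym.
  - by apply: UIE => //; exact: (subsetP IU).
have /maxT/(_ cAUI) : (A :&: U) :|: I \subset T.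
  by rewrite subUset (subset_trans (subsetIr _ _) UT) (subset_trans IU UT).
have -> : #|(A :&: U) :|: I| = #|A :&: U| + #|I :\: A|.
  rewrite cardsU; have -> : A :&: U :&: I = I :&: A.
    by rewrite -setIA (setIidPr IU) setIC.
  by rewrite cardsD; have := subset_leq_card (subsetIl I A); lia.
move=> le_w; exists (U :|: A), (I :&: A); split; first by rewrite subUset UT.
  have := cardsUI U A; have := cardsID A I; rewrite setIC in le_w *; lia.
split.
- by rewrite (subset_trans (subsetIl _ _)) // (subset_trans IU) // subsetUl.
- move=> u z /setUP[uU|uA] /setIP[zI zA]; first exact: UIE.
  exact: cA.
- move=> j; rewrite !inE => /or3P[/eqP->|/eqP->|js].
  + by rewrite (subset_trans (subsetIl _ _)) // IK ?mem_head.
  + exact: subsetIr.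
  + by rewrite (subset_trans (subsetIl _ _)) // IK // inE js orbT.
Qed.

(** * Degree sums and the lower bound *)

Lemma sum_degrees E : partite part E -> \sum_v #|nbr E v| <= 2 * #|E|.
Proof.
move=> pE; apply: (@leq_trans (\sum_v #|[set e in E | v \in e]|)).
  apply: leq_sum => v _.
  have inj : {in nbr E v &, injective (fun u => [set u; v])}.
    move=> a b; rewrite !mem_nbr => aE bE ab.
    have := set21 a v; rewrite ab !inE => /orP[/eqP//|/eqP av].
    by have := partite_edge_neq pE aE; rewrite av eqxx.
  rewrite -(card_in_imset inj) subset_leq_card //.
  by apply/subsetP => _ /imsetP[u uv ->]; rewrite inE -mem_nbr uv set22.
under eq_bigr => v _ do rewrite -sum1dep_card big_mkcondr /=.
rewrite exchange_big /= -sum1_card big_distrr /=; apply: leq_sum => e eE.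
by rewrite -big_mkcond sum1_card muln1 (partite_card_edge pE eE).
Qed.

(** The degrees over [S] sum to at least the number of edges leaving [S], which is the sum of the
    [S]-degrees over the complement. *)
Lemma sum_degrees_outside E S : partite part E ->
  \sum_(v in ~: S) (#|nbr E v| + #|nbr E v :&: S|) <= 2 * #|E|.
Proof.
move=> /sum_degrees; apply: leq_trans.
rewrite big_split /= [leqRHS](bigID (fun v => v \in ~: S)) /= leq_add2l.
under [leqRHS]eq_bigl => v do rewrite inE negbK.
apply: (@leq_trans (\sum_(v in S) \sum_(u in ~: S) (u \in nbr E v : nat))); last first.
  apply: leq_sum => v _; rewrite -sum1_card big_mkcond [leqRHS]big_mkcond /=.
  by apply: leq_sum => u _; case: ifP => //; case: (u \in nbr E v).
rewrite exchange_big /=; apply: leq_sum => v _.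
rewrite -sum1_card big_mkcond [leqRHS]big_mkcond; apply: leq_sum => u _.
by rewrite inE andbC; case: (u \in S) => //=; rewrite nbr_sym; case: (v \in _).
Qed.

Lemma low_degree_bound r E S x : 2 <= r -> 1 < k -> partite part E ->
    partite_saturated part r E ->
    (forall j, j != part x -> exists y, [/\ part y = j, y \notin nbr E x &
       nbr E x :&: nbr E y \subset S]) ->
  2 * (r - 2) <= #|nbr E x :&: S|.
Proof.
move=> r2 k1 pE /andP[nE /forallP sE] hS.
have maxT Q : Q \subset nbr E x :&: S -> clique E Q -> #|Q| <= r - 2.
  rewrite subsetI => /andP[Qx _] cQ; rewrite leqNgt; apply: contra nE => rQ.
  apply: has_clique_geq (clique_setU1 cQ Qx) _.
  have : x \notin Q.
    apply/negP => /(subsetP Qx); rewrite mem_nbr => /(partite_edge_neq pE).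
    by rewrite eqxx.
  by rewrite cardsU1 => ->; lia.
have cl j : exists K : {set V}, j != part x -> [/\ K \subset nbr E x :&: S, clique E K,
    #|K| = r - 2 & forall z, z \in K -> part z != j].
  have [->|jx] := eqVneq j (part x); first by exists set0.
  have [y [yj yx xyS]] := hS j jx.
  have xy : x != y by apply: contraNneq jx => ->; rewrite yj.
  have /forallP/(_ y)/implyP := sE x.
  rewrite /admissible_nonedge yj eq_sym jx -mem_nbr nbr_sym yx.
  move=> /(_ isT)/(new_clique nE xy)[K Kr [cK Kxy]]; exists K => _; split=> //.
    by rewrite subsetI (subset_trans Kxy (subsetIl _ _)) (subset_trans Kxy).
  move=> z /(subsetP Kxy)/setIP[_]; rewrite mem_nbr => /(partite_edge pE).
  by rewrite yj.
have [K KP] := fin_all_exists cl.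
have mems j : (j \in [seq j <- enum 'I_k | j != part x]) = (j != part x).
  by rewrite mem_filter mem_enum andbT.
case es: [seq j <- enum 'I_k | j != part x] mems => [|j0 s] mems.
  have /card_gt1P[a [b [_ _ ab]]] : 1 < #|'I_k| by rewrite card_ord.
  have := mems a; have := mems b; rewrite !in_nil => /esym/eqP eb /esym/eqP ea.
  by rewrite ea eb eqxx in ab.
have [] := max_cliques_bound (s := s) (j0 := j0) (K := K) maxT.
  by move=> j; rewrite mems => /KP[].
move=> U [I [UT UI [IU _ IK]]].
(* [I] avoids the part of [x] because it lies in [nbr E x], and any other part [j] because it lies
   in [K j]. *)
suff I0 : I = set0.
  by rewrite I0 cards0 addn0 in UI; exact: leq_trans (subset_leq_card UT).
apply/setP => z; rewrite inE; apply/negP => zI.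
have zx : part z != part x.
  have /subsetP/(_ z zI)/setIP[] := subset_trans IU UT.
  by rewrite mem_nbr => /(partite_edge pE).
have [_ _ _ Kz] := KP _ zx.
have /IK/subsetP/(_ z zI)/Kz : part z \in j0 :: s by rewrite mems.
by rewrite eqxx.
Qed.

Lemma card_parts n : (forall j, #|[set v | part v == j]| = n) -> #|V| = k * n.
Proof.
move=> Vn; rewrite -sum1_card (partition_big part predT) //=.
under eq_bigr => j _ do rewrite sum1dep_card Vn.
by rewrite sum_nat_const card_ord.
Qed.

(** One round per unit of [t]: [S] absorbs fewer than [2 * m] vertices, and [d], which bounds the
    [S]-degrees outside [S] from below part by part, grows by one at some part. The left alternative
    first arises when no vertex of low degree remains. *)
Lemma dominating_set r n m E t : 2 <= r -> 1 < k ->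
    (forall j, #|[set v | part v == j]| = n) ->
    partite part E -> partite_saturated part r E ->
    m = 2 * (r - 2) ->
  k * m * n <= #|E| + k * m * (2 * m * t) \/
  exists (S : {set V}) (d : 'I_k -> nat), [/\ #|S| <= 2 * m * t,
    forall y, y \notin S -> d (part y) <= #|nbr E y :&: S| & t <= \sum_j d j].
Proof.
move=> r2 k1 Vn pE sE mE.
elim: t => [|t [IHt|[S [d [St dS td]]]]].
- by right; exists set0, (fun=> 0); rewrite cards0; split.
- by left; apply: (leq_trans IHt); rewrite leq_add2l !leq_mul.
have [lowx|] := boolP [exists x, (x \notin S) && (#|nbr E x| + #|nbr E x :&: S| < 2 * m)].
  right; have /existsP[x /andP[xS xm]] := lowx; pose S' := S :|: nbr E x.
  have subS y : nbr E y :&: S \subset nbr E y :&: S' by rewrite setIS ?subsetUl.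
  have degS : m <= #|nbr E x :&: S| -> False.
    by have := subset_leq_card (subsetIl (nbr E x) S); lia.
  have : [exists j, [forall y, (part y == j) && (y \notin S') ==>
                      (#|nbr E y :&: S| < #|nbr E y :&: S'|)]].
    (* If no part gained, each part [j] would have a vertex outside [S'] whose common neighbours
       with [x] all lie in [S], and [low_degree_bound] would contradict the choice of [x]. *)
    rewrite -[X in is_true X]negbK; apply/negP => /existsPn no; apply: degS.
    rewrite mE; apply: low_degree_bound r2 k1 pE sE _ => j _.
    have /forallPn[y] := no j; rewrite negb_imply -leqNgt => /andP[/andP[/eqP yj]].
    rewrite in_setU negb_or => /andP[_ yx] le; exists y; split=> //.
    have /eqP eqS : nbr E y :&: S == nbr E y :&: S' by rewrite eqEcard subS le.
    apply/subsetP => z /setIP[zx zy].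
    have : z \in nbr E y :&: S' by rewrite in_setI zy in_setU zx orbT.
    by rewrite -eqS => /setIP[].
  move=> /existsP[j /forallP jS].
  exists S', (fun i => d i + (i == j)); split.
  - have := cardsU S (nbr E x); rewrite -/S' mulnS; lia.
  - move=> y yS'; have yS : y \notin S by apply: contra yS'; rewrite in_setU => ->.
    have := dS y yS; have := subset_leq_card (subS y); have /implyP := jS y.
    by rewrite yS' andbT; case: eqP => [_ /(_ isT)|_ _]; lia.
  - by rewrite big_split /= -addn1 leq_add // (bigD1 j) //= eqxx leq_addr.
move=> /existsPn highx; left.
have : 2 * m * #|~: S| <= 2 * #|E|.
  apply: leq_trans (sum_degrees_outside S pE); rewrite mulnC -sum_nat_const.
  by apply: leq_sum => x; rewrite inE => xS; have := highx x; rewrite xS /= -leqNgt.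
have := cardsC S; rewrite (card_parts Vn) => cS le.
have : m * (k * n) <= #|E| + m * #|S| by rewrite -cS mulnDr; lia.
have : m * #|S| <= k * m * (2 * m * t.+1).
  rewrite leq_mul //; first by rewrite -{1}[m]mul1n leq_mul // ltnW.
  by apply: leq_trans St _; rewrite leq_mul.
by rewrite mulnCA mulnA; lia.
Qed.

Lemma saturated_lower_bound r n m E : 2 <= r -> 1 < k ->
    (forall j, #|[set v | part v == j]| = n) ->
    partite part E -> partite_saturated part r E ->
    m = 2 * (r - 2) ->
  k * m * n <= #|E| + k * m * (2 * m * (k * (k * m))).
Proof.
move=> r2 k1 Vn pE sE mE.
have [//|[S [d [Sle dS]]]] := dominating_set (k * (k * m)) r2 k1 Vn pE sE mE.
move=> sumd; set M := k * m in sumd Sle *.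
(* This explains the number of rounds: if every [d j] were below [M], their sum would be at most
   [k * M - k]. *)
have /existsP[j Mj] : [exists j, M <= d j].
  rewrite -[X in is_true X]negbK; apply/negP => /existsPn ltM.
  have : \sum_j (d j + 1) <= \sum_(j < k) M.
    by apply: leq_sum => j _; rewrite addn1 ltnNge.
  rewrite big_split /= !sum_nat_const card_ord muln1.
  by move/(leq_trans (leq_add sumd (leqnn k))); lia.
have := sum_degrees_outside S pE.
have : \sum_(v in [set v | part v == j] :\: S) 2 * M <=
    \sum_(v in ~: S) (#|nbr E v| + #|nbr E v :&: S|).
  rewrite big_mkcond [leqRHS]big_mkcond; apply: leq_sum => v _ /=.
  rewrite !inE; case: (boolP (v \in S)) => //= vS; case: eqP => // vj.
  have := dS v vS; have := subset_leq_card (subsetIl (nbr E v) S).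
  rewrite vj; lia.
rewrite sum_nat_const cardsD Vn => le1 le2.
have := leq_trans le1 le2; have := subset_leq_card (subsetIr [set v | part v == j] S).
have : M * #|S| <= M * (2 * m * (k * M)) by rewrite leq_mul.
move: #|_ :&: S| #|S| => a b; nia.
Qed.

End Partite.

(** * Cliques in the complement of a cycle *)

Section Cycle.
Set Implicit Arguments.
Unset Strict Implicit.
Implicit Types (N d h g p q i j s : nat).

(* For [x, y < N]: distinct and non-consecutive on the cycle of length [N]. *)
Definition far N (x y : nat) :=
  (x + 2 <= y) && (y + 2 <= x + N) || (y + 2 <= x) && (x + 2 <= y + N).

Lemma farC N x y : far N x y = far N y x.
Proof. by rewrite /far orbC. Qed.

Lemma farxx N x : far N x x = false.
Proof. by rewrite /far; lia. Qed.

Lemma card_le_inj (T : finType) (A : {set T}) (f : T -> nat) m :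
  {in A, forall x, f x < m} -> {in A &, injective f} -> #|A| <= m.
Proof.
move=> fm inj; rewrite cardE -(size_map f) -(size_iota 0 m).
apply: uniq_leq_size; first by rewrite map_inj_in_uniq ?enum_uniq // => x y;
  rewrite !mem_enum; exact: inj.
by move=> y /mapP[x]; rewrite mem_enum mem_iota => xA ->; rewrite /= fm.
Qed.

(** At most one vertex of each consecutive pair is used, and the length is [2dh + d] with [d <= 3].
    If [N.-1] is used then 0 is not, so the pairs start at 1; otherwise they start at 0. *)
Lemma far_clique_bound d h (T : finType) (A : {set T}) (f : T -> nat) :
    let N := d * h.*2.+1 in 0 < h -> d <= 3 ->
    {in A, forall x, f x < N} -> {in A &, forall x y, x != y -> far N (f x) (f y)} ->
  #|A| <= d * h + 1.
Proof.
move=> N h0 d3 fN farA.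
have NE : N = (d * h).*2 + d by rewrite /N; lia.
have [/existsP[z /andP[zA /eqP fz]]|/existsPn noz] := boolP [exists z, (z \in A) && (f z == N.-1)].
- have gt0 x : x \in A -> 0 < f x.
    move=> xA; have [xz|/(farA x z xA zA)] := eqVneq x z.
      by rewrite xz fz; have := fN z zA; rewrite fz NE; case: (d) => //; nia.
    by rewrite /far fz; have := fN z zA; lia.
  apply: (@card_le_inj _ _ (fun x => (f x).-1./2)) => [x xA|x y xA yA fxy].
    by have := fN x xA; lia.
  apply/eqP/negPn/negP => /(farA x y xA yA); have := gt0 x xA; have := gt0 y yA.
  by rewrite /far; lia.
- apply: (@card_le_inj _ _ (fun x => (f x)./2)) => [x xA|x y xA yA fxy].
    by have := fN x xA; have := noz x; rewrite xA /=; lia.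
  by apply/eqP/negPn/negP => /(farA x y xA yA); rewrite /far; lia.
Qed.

(** Subtraction of [p] modulo [N]; when [g] divides [N] it sends the residue class of [p] mod [g] to
    that of 0. *)
Definition rot N p (x : nat) := if p <= x then x - p else x + N - p.

Lemma rotP d g p (x : nat) : let N := d * g in p < g -> x < N -> x %% g != p ->
  let y := rot N p x in [/\ y < N, 0 < y %% g & y %/ g < d].
Proof.
move=> N pg xN xp y.
have pN : p < N by rewrite /N in xN *; case: (d) xN => [|e]; rewrite ?mul0n // mulSn; lia.
have yN : y < N by rewrite /y /rot; case: (leqP p x); lia.
split=> //; last by rewrite ltn_divLR //; lia.
rewrite lt0n; apply: contraNneq xp => y0.
have : x = y + p %[mod g].
  rewrite /y /rot; case: (leqP p x) => px; first by rewrite subnK.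
  by rewrite subnK; [rewrite /N addnC modnMDl | lia].
by rewrite -modnDml y0 add0n (modn_small pg) => ->.
Qed.

Lemma rot_inj N p x y : p < N -> x < N -> y < N -> rot N p x = rot N p y -> x = y.
Proof. by rewrite /rot; case: (leqP p x); case: (leqP p y); lia. Qed.

Lemma digits_lt (a b m d : nat) : a < d -> b < m -> a * m + b < d * m.
Proof.
move=> ad bm; apply: (@leq_trans (a.+1 * m)); first by rewrite mulSn; lia.
by rewrite leq_mul2r ad orbT.
Qed.

Lemma digits_inj (a b a' b' m : nat) : b < m -> b' < m ->
  a * m + b = a' * m + b' -> a = a' /\ b = b'.
Proof.
by move=> bm bm' e; have := edivn_eq a bm; rewrite e edivn_eq // => -[].
Qed.

Lemma card_residue_avoiding d h p (T : finType) (A : {set T}) (f : T -> nat) :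
    let g := h.*2.+1 in let N := d * g in p < g ->
    {in A, forall x, f x < N /\ f x %% g != p} -> {in A &, injective f} ->
  #|A| <= d * h.*2.
Proof.
move=> g N pg fA inj.
have ok x : x \in A -> _ := fun xA => rotP pg (proj1 (fA x xA)) (proj2 (fA x xA)).
have lt_h y : 0 < y %% g -> (y %% g).-1 < h.*2.
  by have := ltn_pmod y (ltn0Sn h.*2); rewrite -/g; lia.
(* After rotation the avoided class is 0, so the remainder minus one is a digit below [2h]. *)
apply: (@card_le_inj _ _ (fun x => let y := rot N p (f x) in
  y %/ g * h.*2 + (y %% g).-1)) => [x xA|x y xA yA] /=.
  by have [_ y0 yd] := ok x xA; apply: digits_lt => //; exact: lt_h.
have [_ y0 yd] := ok x xA; have [_ y0' yd'] := ok y yA.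
case/(digits_inj (lt_h _ y0) (lt_h _ y0')) => eq_q eq_p.
have [f1 _] := fA x xA; have [f2 _] := fA y yA.
apply: inj => //; apply: (rot_inj (N := N) (p := p)) => //.
  by apply: leq_trans pg _; rewrite leq_pmull //; exact: leq_ltn_trans yd.
rewrite (divn_eq (rot N p (f x)) g) (divn_eq (rot N p (f y)) g) eq_q.
by rewrite -(prednK y0) -(prednK y0') eq_p.
Qed.

(* Away from one residue class mod [g = 2h+1] the cycle splits into [d] paths
   of [2h] vertices, i.e. into [d * h] pairs of consecutive vertices. *)
Lemma far_residue_bound d h p (T : finType) (A : {set T}) (f : T -> nat) :
    let g := h.*2.+1 in let N := d * g in p < g ->
    {in A, forall x, f x < N /\ f x %% g != p} ->
    {in A &, forall x y, x != y -> far N (f x) (f y)} ->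
  #|A| <= d * h.
Proof.
move=> g N pg fA farA.
have ok x : x \in A -> _ := fun xA => rotP pg (proj1 (fA x xA)) (proj2 (fA x xA)).
have lt_h y : 0 < y %% g -> (y %% g).-1./2 < h.
  by have := ltn_pmod y (ltn0Sn h.*2); rewrite -/g; lia.
(* The code numbers the pairs of remainders {1,2}, {3,4}, ... in each block of length [g]; two
   vertices with the same code are equal or consecutive. *)
apply: (@card_le_inj _ _ (fun x => let y := rot N p (f x) in
  y %/ g * h + (y %% g).-1./2)) => [x xA|x y xA yA] /=.
  by have [_ y0 yd] := ok x xA; apply: digits_lt => //; exact: lt_h.
have [_ y0 yd] := ok x xA; have [_ y0' yd'] := ok y yA.
case/(digits_inj (lt_h _ y0) (lt_h _ y0')) => eq_q eq_p.
apply/eqP/negPn/negP => /(farA x y xA yA).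
have [f1 _] := fA x xA; have [f2 _] := fA y yA.
have pN : p < N.
  by apply: leq_trans pg _; rewrite leq_pmull //; exact: leq_ltn_trans yd.
have : (rot N p (f x) <= (rot N p (f y)).+1) && (rot N p (f y) <= (rot N p (f x)).+1).
  rewrite (divn_eq (rot N p (f x)) g) (divn_eq (rot N p (f y)) g) eq_q.
  have near a b c : 0 < a -> 0 < b -> a.-1./2 = b.-1./2 ->
    (c + a <= (c + b).+1) && (c + b <= (c + a).+1) by clear; lia.
  exact: near.
rewrite /rot /far; move: (f x) (f y) pN f1 f2 => a b; clear.
by case: (leqP p a); case: (leqP p b); lia.
Qed.

(** Laying [d] short cycles end to end keeps far vertices far: at a seam, [g - 1] meets 0, and these
    are already consecutive on the short cycle. *)
Lemma far_lift d g q q' (a b : nat) : 2 < g -> a < g -> b < g -> q < d -> q' < d ->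
    (a == b) && (q != q') || far g a b ->
  far (d * g) (q * g + a) (q' * g + b).
Proof.
wlog le_qq : q q' a b / q <= q' => [hw g2 ag bg qd qd' ab|].
  have [/hw|/ltnW/hw] := leqP q q'; first exact.
  by rewrite farC; apply=> //; rewrite farC eq_sym [q' == q]eq_sym.
move=> g2 ag bg qd qd'.
have : q'.+1 * g <= d * g by rewrite leq_mul2r qd' orbT.
move: le_qq; rewrite leq_eqVlt => /orP[/eqP->|lt_qq].
  by rewrite eqxx andbF /= mulSn /far; move: (q' * g) (d * g); lia.
have : q.+1 * g <= q' * g by rewrite leq_mul2r lt_qq orbT.
by rewrite !mulSn /far; move: (q * g) (q' * g) (d * g) => u v w; lia.
Qed.

(* [d] copies of the maximum independent set {t, t+2, ..., t+2(h-1)} of the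
   cycle of length [2h+1], where t-1 is the residue from which the other
   one is reached in an even number of steps. *)
Lemma far_family_avoiding d h p p' :
    let g := h.*2.+1 in let N := d * g in 0 < h -> p < g -> p' < g ->
  exists f : nat -> nat, [/\ forall i, i < d * h -> f i < N,
    forall i, i < d * h -> (f i %% g != p) && (f i %% g != p') &
    forall i j, i < d * h -> j < d * h -> i != j -> far N (f i) (f j)].
Proof.
move=> g N h0 pg p'g.
(* For distinct [p] and [p'], the distances from [p] to [p'] and back sum to the odd [g], so one of
   them is even. *)
wlog even_pp : p p' pg p'g / ~~ odd (if p <= p' then p' - p else p' + g - p) => [hw|].
  have [/hw|odd_pp] := boolP (~~ odd (if p <= p' then p' - p else p' + g - p)); first exact.
  have [] := hw p' p => //.
    by move: odd_pp; rewrite /g; case: (leqP p p'); case: (leqP p' p); lia.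
  move=> f [f1 f2 f3]; exists f; split=> // i /f2.
  by rewrite andbC.
(* [a j] is [2j + 1 < g] steps past [p], an odd number, whereas [p'] is an even number of steps past
   [p]. *)
pose a j := if p + 1 + j.*2 < g then p + 1 + j.*2 else p + 1 + j.*2 - g.
have aP j : j < h -> [&& a j < g, a j != p & a j != p'].
  by move: even_pp; rewrite /a /g; case: (leqP p p'); case: (ltnP (p + 1 + j.*2)); lia.
have a_far i j : i < h -> j < h -> i != j -> far g (a i) (a j).
  by rewrite /far /a /g; case: (ltnP (p + 1 + i.*2)); case: (ltnP (p + 1 + j.*2)); lia.
have modh i : i %% h < h by rewrite ltn_mod.
exists (fun i => i %/ h * g + a (i %% h)); split=> [i ilt|i ilt|i j ilt jlt ij].
- have /and3P[ag _ _] := aP _ (modh i); apply: digits_lt => //.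
  by rewrite ltn_divLR.
- have /and3P[ag ap ap'] := aP _ (modh i).
  by rewrite modnMDl modn_small // ap ap'.
- have /and3P[ag _ _] := aP _ (modh i); have /and3P[bg _ _] := aP _ (modh j).
  apply: far_lift; rewrite ?ltn_divLR //; first by rewrite /g; lia.
  have [eq_m|ne_m] := eqVneq (i %% h) (j %% h); last by rewrite a_far ?orbT.
  rewrite eq_m eqxx /=; apply/orP; left; apply: contra ij => /eqP eq_d.
  by rewrite (divn_eq i h) (divn_eq j h) eq_d eq_m.
Qed.

(* Read from [s], the family is every second vertex of the arc of length
   [4h+1] centred at [s], plus, for [d = 3], a maximum independent set of
   the opposite arc of length [2h]. *)
Lemma far_family_around d h s :
    let g := h.*2.+1 in let N := d * g in 0 < h -> 1 < d <= 3 -> s < N ->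
  exists f : nat -> nat, [/\ forall i, i < d * h -> f i < N,
    forall i, i < d * h -> (f i %% g != s %% g) && far N (f i) s &
    forall i j, i < d * h -> j < d * h -> i != j -> far N (f i) (f j)].
Proof.
move=> g N h0 d23 sN.
(* Offsets from [s]: 2, 4, ..., 2h forwards, the same backwards, and for [d = 3] also g+1, g+3, ...,
   4h. *)
pose o i := if i < h then i.*2 + 2 else
            if i < h.*2 then N - (i - h).*2 - 2 else g + 1 + (i - h.*2).*2.
have dN : (N = g.*2 /\ d * h = h.*2) \/ (N = g * 3 /\ d * h = h * 3).
  rewrite /N; have [->|->] : d = 2 \/ d = 3 by clear -d23; lia.
    by left; rewrite !mul2n.
  by right; rewrite ![3 * _]mulnC.
have oP i : i < d * h -> [/\ 2 <= o i, o i + 2 <= N & ~~ (g %| o i)].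
  (* Each offset lies strictly between consecutive multiples of [g], so adding it to [s] leaves the
     residue class of [s]. *)
  move=> ilt; have [c [e [oE e0 eg]]] : exists c e, [/\ o i = c * g + e, 0 < e & e < g].
    rewrite /o; case: (ltnP i h) => ih; first by exists 0, (i.*2 + 2); split; lia.
    case: (ltnP i h.*2) => ih2; last by exists 1, (1 + (i - h.*2).*2); split; lia.
    by case: dN => -[-> _]; [exists 1, (g - (i - h).*2 - 2)|exists 2, (g - (i - h).*2 - 2)];
      split; lia.
  split; last by rewrite oE dvdn_addr ?dvdn_mull // gtnNdvd.
    by rewrite /o /g; case: (ltnP i h); case: (ltnP i h.*2); lia.
  by rewrite /o; case: (ltnP i h); case: (ltnP i h.*2); lia.
have o_far i j : i < d * h -> j < d * h -> i != j -> far N (o i) (o j).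
  move=> ilt jlt ij; rewrite /o /far.
  by case: (ltnP i h); case: (ltnP i h.*2); case: (ltnP j h); case: (ltnP j h.*2); lia.
exists (fun i => if s + o i < N then s + o i else s + o i - N).
split=> [i /oP[]|i /oP[o2 oN og]|i j ilt jlt ij].
- by case: (ltnP (s + o i)); lia.
- apply/andP; split; last by rewrite /far; case: (ltnP (s + o i)); lia.
  apply: contra og => /eqP es.
  suff: s + o i == s + 0 %[mod g] by rewrite eqn_modDl mod0n.
  rewrite addn0 -es; case: ltnP => // Ns.
  by rewrite -{1}(subnK Ns) addnC /N modnMDl.
- have := o_far i j ilt jlt ij; have [i1 i2 _] := oP i ilt; have [j1 j2 _] := oP j jlt.
  move: (o i) (o j) i1 i2 j1 j2 => u v; clearbody N; move: sN; clear.
  by rewrite /far; case: (ltnP (s + u)) => ?; case: (ltnP (s + v)) => ?; lia.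
Qed.

End Cycle.

(** * Maximal clique-free extensions *)

Section MaximalExtension.
Set Implicit Arguments.
Unset Strict Implicit.
Variables (V : finType) (k : nat) (part : V -> 'I_k).
Implicit Types (E : {set {set V}}) (K : {set V}).

Lemma saturated_extension r E0 : partite part E0 -> ~~ has_clique r E0 ->
  exists2 E : {set {set V}}, E0 \subset E & partite part E /\ partite_saturated part r E.
Proof.
move=> pE0 nE0; pose P E := partite part E && ~~ has_clique r E.
have P0 : P E0 by rewrite /P pE0.
have [E maxE E0E] := maxset_exists P0; have /andP[pE nE] := maxsetp maxE.
exists E => //; split=> //; rewrite /partite_saturated nE /=.
apply/forallP => u; apply/forallP => v; apply/implyP => /andP[uv].
apply: contraR => nuv.
have /(maxsetsup maxE) : P ([set u; v] |: E).
  rewrite /P nuv andbT; apply/forall_inP => e /setU1P[->|eE]; last exact: (forall_inP pE).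
  by apply/existsP; exists u; apply/existsP; exists v; rewrite uv eqxx.
by rewrite subsetUr => /(_ isT) <-; rewrite setU11.
Qed.

(** It excludes from a K_r-free extension every edge whose ends have a common clique of [r - 2]
    neighbours. *)
Lemma clique_join E u v K : clique E K -> K \subset nbr E u :&: nbr E v ->
  [set u; v] \in E -> u != v -> partite part E -> has_clique (#|K| + 2) E.
Proof.
move=> cK; rewrite subsetI => /andP[Ku Kv] uvE uv pE.
have nin w : K \subset nbr E w -> w \notin K.
  move=> /subsetP Kw; apply/negP => /Kw; rewrite mem_nbr => /(partite_edge_neq pE).
  by rewrite eqxx.
have cvK := clique_setU1 cK Kv.
have uvK : v |: K \subset nbr E u.
  by apply/subsetP => w /setU1P[->|/(subsetP Ku)//]; rewrite mem_nbr setUC.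
apply: has_clique_geq (clique_setU1 cvK uvK) _.
by rewrite !cardsU1 in_setU1 (negbTE uv) !nin //= add1n add1n addn2.
Qed.

End MaximalExtension.

(** * The sparse saturated graph *)

Section Construction.
Set Implicit Arguments.
Unset Strict Implicit.
Variables (d h k n : nat).
Let g := h.*2.+1.
Let N := d * g.
Hypotheses (h_gt0 : 0 < h) (d_range : 0 < d <= 3) (Nk : N <= k)
  (d1 : d = 1 -> k = N) (n_gt0 : 0 < n).
Let V : finType := ('I_k * 'I_n)%type.
Implicit Types (u v w : V) (K Q : {set V}) (e : {set V}).

Definition core v := (v.2 == 0 :> nat) && (v.1 < N).

(* A vertex outside the core is linked to the core vertices whose residue
   modulo [g] is not [missed v]; for parts without a core vertex, 0 is an
   arbitrary choice. *)
Definition missed v := if v.1 < N then v.1 %% g else 0.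

Definition link u v :=
  if core u then if core v then far N u.1 v.1 else u.1 %% g != missed v
  else core v && (v.1 %% g != missed u).

Definition base : {set {set V}} :=
  [set [set p.1; p.2] | p in [set p : V * V | link p.1 p.2]].

Lemma core_lt v : core v -> v.1 < N. Proof. by case/andP. Qed.

Lemma core_inj u v : core u -> core v -> u.1 = v.1 :> nat -> u = v.
Proof.
case: u v => [u1 u2] [v1 v2] /andP[/eqP /= u0 _] /andP[/eqP /= v0 _] uv.
by congr (_, _); apply: val_inj; rewrite //= u0 v0.
Qed.

Lemma missed_lt v : missed v < g.
Proof. by rewrite /missed; case: ifP => // _; rewrite ltn_pmod. Qed.

Lemma link_sym u v : link u v = link v u.
Proof. by rewrite /link farC; case: (core u); case: (core v). Qed.

Lemma link_part u v : link u v -> u.1 != v.1.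
Proof.
apply: contraTneq => uv; rewrite /link /missed uv.
have [/core_lt cu|_] := boolP (core u); have [/core_lt cv|_] := boolP (core v);
  rewrite ?farxx //= -?uv ?cu ?eqxx //.
by rewrite uv cv eqxx.
Qed.

Lemma mem_base u v : ([set u; v] \in base) = link u v.
Proof.
apply/imsetP/idP => [[[a b]] | uv]; last by exists (u, v); rewrite ?inE.
rewrite inE /= => ab eq_uv.
have ne_ab : a != b by apply: contraTneq ab => ->; apply/negP => /link_part; rewrite eqxx.
have : u \in [set a; b] by rewrite -eq_uv set21.
have : v \in [set a; b] by rewrite -eq_uv set22.
have : a \in [set u; v] by rewrite eq_uv set21.
have : b \in [set u; v] by rewrite eq_uv set22.
rewrite !inE => /orP[]/eqP eb /orP[]/eqP ea; move: ab ne_ab; rewrite ea eb ?eqxx //.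
by rewrite link_sym.
Qed.

Lemma base_partite : partite (blowup_part k n) base.
Proof.
apply/forall_inP => e /imsetP[[a b]]; rewrite inE /= => /link_part ab ->.
by apply/existsP; exists a; apply/existsP; exists b; rewrite ab eqxx.
Qed.

Lemma core_clique_far Q : clique base Q -> {in Q, forall v, core v} ->
  {in Q &, forall u v, u != v -> far N u.1 v.1}.
Proof.
move=> /cliqueP cQ coreQ u v uQ vQ /(cQ u v uQ vQ).
by rewrite mem_base /link !coreQ.
Qed.

(** A clique has at most one vertex [v] outside the core, since such vertices are pairwise unlinked.
    With [v], the core vertices avoid the class [missed v] and number at most [d * h]; without it,
    at most [d * h + 1]. *)
Lemma base_clique_free : ~~ has_clique (d * h + 2) base.
Proof.
apply/negP => /has_cliqueP[Q Qr cQ].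
have [/existsP[v /andP[vQ vcore]]|/existsPn noQ] := boolP [exists v, (v \in Q) && ~~ core v].
- have linkQ u : u \in Q :\ v -> core u /\ u.1 %% g != missed v.
    move=> /setD1P[uv uQ]; have /cliqueP/(_ u v uQ vQ uv) := cQ.
    by rewrite mem_base /link (negbTE vcore); case: (core u).
  have := @far_residue_bound d h (missed v) V (Q :\ v) (fun u => u.1) (missed_lt v).
  rewrite (cardsD1 v) vQ in Qr => le_dh.
  suff : #|Q :\ v| <= d * h by lia.
  apply: le_dh => [u /linkQ[cu ru]|]; first by rewrite core_lt.
  apply: core_clique_far => [|u /linkQ[]//].
  by apply: clique_subset cQ; exact: subD1set.
- have coreQ : {in Q, forall v, core v}.
    by move=> v vQ; have := noQ v; rewrite vQ negbK.
  have := @far_clique_bound d h V Q (fun u => u.1) h_gt0 (proj2 (andP d_range)).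
  rewrite Qr => le_dh; suff : d * h + 2 <= d * h + 1 by lia.
  apply: le_dh => [u /coreQ/core_lt//|]; exact: core_clique_far.
Qed.

Lemma core_vertex i : i < N -> exists v : V, core v /\ v.1 = i :> nat.
Proof.
move=> iN; exists (Ordinal (leq_trans iN Nk), Ordinal n_gt0).
by rewrite /core /= iN.
Qed.

Lemma far_family_clique (f : nat -> nat) m :
    (forall i, i < m -> f i < N) ->
    (forall i j, i < m -> j < m -> i != j -> far N (f i) (f j)) ->
  exists K : {set V}, [/\ #|K| = m, clique base K &
    forall v, v \in K -> core v /\ exists2 i, i < m & v.1 = f i :> nat].
Proof.
move=> fN far_f.
have cex (i : 'I_m) : exists v : V, core v /\ v.1 = f i :> nat.
  by apply: core_vertex; exact: fN.
have [c cP] := fin_all_exists cex.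
have far_c i j : i != j -> far N (c i).1 (c j).1.
  by move=> ij; rewrite (proj2 (cP i)) (proj2 (cP j)) far_f.
exists (c @: [set: 'I_m]); split.
- rewrite card_imset ?cardsT ?card_ord // => i j ij.
  by apply/eqP/negPn/negP => /far_c; rewrite ij farxx.
- apply/cliqueP => _ _ /imsetP[i _ ->] /imsetP[j _ ->] ij.
  rewrite mem_base /link (proj1 (cP i)) (proj1 (cP j)) far_c //.
  by apply: contraNneq ij => ->.
- by move=> _ /imsetP[i _ ->]; have [ci fi] := cP i; split=> //; exists i.
Qed.

(** If one end is in the core, the family around it also avoids the class missed by the other end;
    if neither is, a family avoiding both missed classes serves. *)
Lemma nonlink_clique u v : u.1 != v.1 -> ~~ (core u && core v) -> ~~ link u v ->
  exists K : {set V}, [/\ #|K| = d * h, clique base K & K \subset nbr base u :&: nbr base v].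
Proof.
wlog nu : u v / ~~ core u => [hw|].
  move=> uv; rewrite negb_and => /orP[nu nl|nv].
    by apply: (hw u v nu uv _ nl); rewrite negb_and nu.
  rewrite link_sym setIC => nl; apply: (hw v u nv _ _ nl); last by rewrite negb_and nv.
  by rewrite eq_sym.
move=> uv _; rewrite /link (negbTE nu); have [cv /= /negPn/eqP vu|nv _] := boolP (core v).
(* For [d = 1] every part has a core vertex and residues mod [g = N] determine the part, so [u]
   would lie in the part of [v]. *)
- have d_gt1 : 1 < d <= 3.
    case/andP: d_range => d0 ->; rewrite andbT ltn_neqAle d0 andbT eq_sym.
    apply: contraNneq uv => d_eq1; apply/eqP/val_inj => /=.
    have kg : k <= g by rewrite (d1 d_eq1) /N d_eq1 mul1n.
    have lt_g (w : V) : w.1 < g := leq_trans (ltn_ord w.1) kg.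
    by move: vu; rewrite /missed /N d_eq1 mul1n lt_g !modn_small //.
  case: (far_family_around h_gt0 d_gt1 (core_lt cv)) => f [fN fs f_far].
  have [K [Kd cK KP]] := far_family_clique fN f_far.
  exists K; split=> //; apply/subsetP => w /KP[cw [i /fs/andP[ri fi] wi]].
  by rewrite inE !mem_nbr !mem_base /link cw cv (negbTE nu) wi fi -vu ri.
- case: (far_family_avoiding d h_gt0 (missed_lt u) (missed_lt v)) => f [fN fs f_far].
  have [K [Kd cK KP]] := far_family_clique fN f_far.
  exists K; split=> //; apply/subsetP => w /KP[cw [i /fs/andP[ri fi] wi]].
  by rewrite inE !mem_nbr !mem_base /link cw (negbTE nv) (negbTE nu) wi ri fi.
Qed.

Lemma card_core_links v : #|[set c | core c & c.1 %% g != missed v]| <= d * h.*2.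
Proof.
apply: (@card_residue_avoiding d h (missed v) _ _ (fun u : V => u.1) (missed_lt v)).
  by move=> c; rewrite inE => /andP[/core_lt].
by move=> a b; rewrite !inE => /andP[ca _] /andP[cb _]; exact: core_inj.
Qed.

Lemma card_core : #|[set v | core v]| <= k.
Proof.
apply: (@card_le_inj _ _ (fun v : V => v.1)) => [v _|a b]; first exact: ltn_ord.
by rewrite !inE; exact: core_inj.
Qed.

Lemma sparse_saturated_graph :
  exists2 E : {set {set V}}, saturated_graph n k (d * h + 2) E & #|E| <= k * n * (d * h.*2) + 2 ^ k.
Proof.
have [E baseE [pE sE]] := saturated_extension base_partite base_clique_free.
exists E; first by rewrite /saturated_graph pE.
have nE : ~~ has_clique (d * h + 2) E by case/andP: sE.
pose L := [set p : V * V | core p.2 && (p.2.1 %% g != missed p.1)].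
(* An edge not inside the core must be a link, by [nonlink_clique] and [clique_join]. Edges inside
   the core are subsets of at most [k] vertices, hence the term [2 ^ k]. *)
have cover : E \subset [set [set p.1; p.2] | p in L] :|: powerset [set v | core v].
  apply/subsetP => e eE; have /forall_inP/(_ e eE) := pE.
  move=> /existsP[u /existsP[v /andP[uv /eqP ee]]]; subst e.
  have [/andP[cu cv]|ncore] := boolP (core u && core v).
    by rewrite inE powersetE; apply/orP; right; apply/subsetP => w;
      rewrite !inE => /orP[]/eqP->.
  have : link u v.
    apply: contraNT nE => nuv; have [K [Kd cK Kuv]] := nonlink_clique uv ncore nuv.
    have cKE : clique E K.
      apply/cliqueP => a b aK bK ab; apply: (subsetP baseE).
      by have /cliqueP/(_ a b aK bK ab) := cK.
    have KuvE : K \subset nbr E u :&: nbr E v.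
      apply: subset_trans Kuv _; apply/subsetP => w /setIP[].
      by rewrite !mem_nbr in_setI !mem_nbr => wu wv; rewrite !(subsetP baseE).
    by rewrite -Kd; exact: clique_join cKE KuvE eE (partite_edge_neq pE eE) pE.
  move: ncore; rewrite inE /link; have [cu /= ncv|ncu _ /andP[cv r]] := boolP (core u).
    rewrite (negbTE ncv) => r; apply/orP; left; apply/imsetP; exists (v, u).
      by rewrite inE /= cu.
    by rewrite setUC.
  by apply/orP; left; apply/imsetP; exists (u, v); rewrite ?inE /= ?cv.
apply: leq_trans (subset_leq_card cover) _.
rewrite (leq_trans (leq_card_setU _ _)) // leq_add //; last first.
  by rewrite card_powerset leq_exp2l // card_core.
rewrite (leq_trans (leq_imset_card _ _)) //.
have -> : #|L| = \sum_(v : V) #|[set c | core c & c.1 %% g != missed v]|.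
  under eq_bigr => v _ do rewrite -sum1dep_card.
  by rewrite pair_big_dep /= sum1dep_card.
apply: leq_trans (leq_sum _ (fun v _ => card_core_links v)) _.
by rewrite sum_nat_const card_prod !card_ord.
Qed.

End Construction.

(** * Parameters and the asymptotics *)

Lemma cycle_parameters (k r : nat) : 3 <= r ->
    [\/ k = 2 * r - 3, 2 * r - 2 <= k /\ r = 0 %[mod 2]
      | 2 * r - 1 <= k /\ r = 2 %[mod 3]] ->
  exists d h, [/\ r = d * h + 2, 0 < h, 0 < d <= 3,
    d * h.*2.+1 <= k & (d = 1 -> k = d * h.*2.+1)].
Proof.
(* As [d * h.*2.+1] is [2(r - 2) + d], the thresholds [2r - 3], [2r - 2], [2r - 1] are the cycle
   lengths for [d = 1, 2, 3]; the congruences say that [d] divides [r - 2]. *)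
move=> r3 [kE|[rk r2]|[rk r23]].
- by exists 1, (r - 2); split; lia.
- by exists 2, (r - 2)./2; split; lia.
- by exists 3, ((r - 2) %/ 3); split; lia.
Qed.

Theorem theorem1p3 (k r : nat) (hr : 3 <= r) (hk : r <= k)
  (hkr : [\/ k = 2 * r - 3,
             2 * r - 2 <= k /\ r = 0 %[mod 2]
           | 2 * r - 1 <= k /\ r = 2 %[mod 3]]) :
  exists C N : nat, forall n : nat, N <= n ->
    (`| (sat n k r)%:Z - (k * (2 * r - 4) * n)%:Z | <= C%:Z)%R.
Proof.
have [d [h [rE h0 d_range Nk d1]]] := cycle_parameters hr hkr.
pose m := 2 * (r - 2); have mE : 2 * r - 4 = m by rewrite /m; lia.
(* The constant adds the losses of the two bounds; [n >= 1] provides the core vertices. *)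
exists (k * m * (2 * m * (k * (k * m))) + 2 ^ k), 1 => n n0.
have [[E /andP[pE sE] cE] sat_min] := Defs.satP n k (ltnW hr).
have parts j : #|[set v | blowup_part k n v == j]| = n.
  have -> : [set v | blowup_part k n v == j] = setX [set j] [set: 'I_n].
    by apply/setP => v; rewrite !inE andbT.
  by rewrite cardsX cards1 cardsT card_ord mul1n.
have lower := saturated_lower_bound (ltnW hr) (leq_trans (ltnW hr) hk) parts pE sE (erefl m).
have [E' satE' leE'] := sparse_saturated_graph h0 d_range Nk d1 n0.
have upper : sat n k r <= k * n * m + 2 ^ k.
  have -> : m = d * h.*2 by rewrite /m rE; lia.
  by apply: leq_trans leE'; apply: sat_min; rewrite rE.
rewrite cE in lower; rewrite mE; move: lower upper.
move: (2 ^ k) (k * m * (2 * m * _)) (sat n k r) => a b c.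
by rewrite mulnAC; move: (k * n * m) => x; lia.
Qed.
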